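(* Let $\Gamma$ be a finite connected loose graph and let $xy$ be an edge with two distinct vertices $x$ and $y$. With $\Delta$, $G$, $G^L$, $G^L_x$, $G^L_y$, the connected components $\{\mathcal C^j\mid j\in J\}$ of $G^L$, and the loose graphs $\mathcal C^j_x$, $\mathcal C^j_y$, $C(G^L,xy)$ defined as in the context, one has $$\begin{aligned}\mathbb P(\Gamma)-\mathbb P(\Gamma_{xy})={}&\bigl(\mathbb P(C(G^L,xy))-\mathbb P(G^L)\bigr)-\mathbb P\bigl((\mathbb A_x\cap C(G^L,xy))\setminus G^L\bigr)-\mathbb P\bigl((\mathbb A_y\cap C(G^L,xy))\setminus G^L\bigr)\\&-\sum_{j\in J}(\underline{\mathbb L}^2-1)\mathbb P(\mathcal C^j)+\sum_{j\in J}(\underline{\mathbb L}-1)\mathbb P(\mathcal C^j_x)+\sum_{j\in J}(\underline{\mathbb L}-1)\mathbb P(\mathcal C^j_y).\end{aligned}$$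
   Context: A loose graph is a triple $(V,E,\mathbf I)$ of vertices, edges and a symmetric incidence relation between vertices and edges such that each edge is incident with at most two distinct vertices (so an edge may have two, one or no vertices); no loops, undirected. Edges with fewer than two vertices are called loose. Ambient space: let $\overline\Gamma$ be the graph obtained from $\Gamma$ by adding a second, new vertex to each edge having only one vertex (and two new vertices to each edge having none), with vertex set $\overline V$; $\mathbf P(\Gamma)$ is the projective space with one homogeneous coordinate $X_w$ for each $w\in\overline V$. For $v\in V$, $\mathbb A_v$ is the affine space of dimension $\deg(v)$ given by $X_v\ne0$ and $X_w=0$ for every $w\in\overline V\setminus\{v\}$ not adjacent to $v$ in $\overline\Gamma$. An edge with no vertices gives a multiplicative group. $\mathcal F(\Gamma)$ is the union of these pieces, and $\mathbb P(\Gamma)$, the Grothendieck polynomial, is its class, a polynomial in the class $\underline{\mathbb L}$ of the affine line; substituting $q$ for $\underline{\mathbb L}$ gives the number of $\mathbb F_q$-rational points of $\mathcal F(\Gamma)\otimes_{\mathbb F_1}\mathbb F_q$ for every finite field $\mathbb F_q$. The same notation $\mathbb P(\cdot)$ is used for constructible subsets of $\mathbf P(\Gamma)$ whose points are counted by a polynomial. Resolution: $\Gamma_{xy}$ is the loose graph obtained from $\Gamma$ by deleting the edge $xy$ and adding two new loose edges, one incident only with $x$ and one incident only with $y$. $\overline{\mathbf B}(c,1)$ is the set of vertices at distance at most $1$ from $c$ in $\Gamma$. $\Delta$ is the graph (without loose edges) induced by $\Gamma$ on $(\overline{\mathbf B}(x,1)\cup\overline{\mathbf B}(y,1))\setminus\{x,y\}$;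 $G$ is the graph induced by $\Gamma$ on $(\overline{\mathbf B}(x,1)\cap\overline{\mathbf B}(y,1))\setminus\{x,y\}$. $G^L$ is the loose graph with the vertices of $G$ as its vertices and with edges those edges of $\Delta$ that contain a vertex of $G$. $G^L_x$ (resp. $G^L_y$) is the loose graph with the vertices of $G$ as its vertices and with edges those edges of $\Delta$ containing a vertex of $G$ and a vertex of $\overline{\mathbf B}(x,1)\setminus\{y\}$ (resp. of $\overline{\mathbf B}(y,1)\setminus\{x\}$) (both ends of such an edge being counted, so that $G$ is a subgraph of both). The connected components of $G^L$ correspond to the connected components of $G$. $\mathcal C^j_x=\mathcal C^j\cap G^L_x$ and $\mathcal C^j_y=\mathcal C^j\cap G^L_y$. $C(G^L,xy)$ is the loose graph obtained by adding to $G^L$ the vertices $x,y$, the edge $xy$, and all edges of $\Gamma$ joining $x$ or $y$ to a vertex of $G$. All these loose subgraphs $\Lambda$ are taken with their embedding in $\Gamma$: the corresponding set is the union, over the vertices $v$ of $\Lambda$, of the loci in $\mathbf P(\Gamma)$ given by $X_v\ne0$ and $X_w=0$ for every $w\ne v$ that is not the other end (in $\Gamma$) of an edge of $\Lambda$ incident with $v$; $\mathbb P(\Lambda)$ is the class of this set, and set operations such as $(\mathbb A_x\cap C(G^L,xy))\setminus G^L$ refer to these sets, with $\mathbb A_x,\mathbb A_y$ formed in $\Gamma$ (before resolution). *)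

(* Defs.v *)
From HB Require Import structures.
From mathcomp Require Import all_boot all_order all_algebra.
From Stdlib Require Import ClassicalEpsilon.

Set Implicit Arguments.
Unset Strict Implicit.
Unset Printing Implicit Defensive.

Import Order.TTheory GRing.Theory Num.Theory.
Local Open Scope ring_scope.

(* An edge is an abstract element with at most two incident vertices; those   *)
(* with fewer than two are the loose edges, and several of them may be        *)
(* attached to the same vertex. An edge with two vertices is determined by    *)
(* them (it is written xy), i.e. there are no parallel edges.                 *)
Record looseGraph := LooseGraph {
  vertex : finType;
  edge : finType;
  inc : vertex -> edge -> bool;
  inc_le2 : forall e, (#|[set v | inc v e]| <= 2)%N;
  inc_inj : forall e f, #|[set v | inc v e]| = 2%N ->
    [set v | inc v e] = [set v | inc v f] -> e = f
}.

Section LooseGraphs.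
Variable Gam : looseGraph.
Implicit Types (u v c : vertex Gam) (e : edge Gam).

Definition ends e : {set vertex Gam} := [set v | inc v e].

Definition adj u v : bool := (u != v) && [exists e, inc u e && inc v e].

Definition ball1 c : {set vertex Gam} := [set v | (v == c) || adj c v].

(* The vertices of the completed graph: each edge e receives 2 - #|ends e|    *)
(* new vertices.                                                              *)
Definition vbar : finType :=
  (vertex Gam + {e : edge Gam & 'I_(2 - #|ends e|)})%type.

Definition incbar (w : vbar) e : bool :=
  match w with inl v => inc v e | inr t => tag t == e end.

Definition adjbar (w z : vbar) : bool :=
  (w != z) && [exists e, incbar w e && incbar z e].

(* Loose subgraphs with their embedding: an edge of the subgraph may have     *)
(* ends in Gam that are not vertices of the subgraph.                         *)
Definition subgraph : finType := ({set vertex Gam} * {set edge Gam})%type.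
Implicit Types L : subgraph.

Definition full : subgraph := (setT, setT).

Definition elements L : {set vertex Gam + edge Gam} :=
  [set z | match z with inl v => v \in L.1 | inr e => e \in L.2 end].

Definition incidence L : rel (vertex Gam + edge Gam) := fun z t =>
  [&& z \in elements L, t \in elements L &
    match z, t with
    | inl v, inr e | inr e, inl v => inc v e
    | _, _ => false
    end].

Definition component L z : subgraph :=
  ([set v in L.1 | connect (incidence L) z (inl v)],
   [set e in L.2 | connect (incidence L) z (inr e)]).

Definition components L : {set subgraph} :=
  [set component L z | z in elements L].

Definition connected : Prop :=
  forall z t : vertex Gam + edge Gam, connect (incidence full) z t.

Definition subgraphI L L' : subgraph := (L.1 :&: L'.1, L.2 :&: L'.2).

Definition induced (A : {set vertex Gam}) : subgraph :=
  (A, [set e | (#|ends e| == 2%N) && (ends e \subset A)]).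

End LooseGraphs.

Section Resolution.
Variables (Gam : looseGraph) (x y : vertex Gam) (xy : edge Gam).

Definition resolve_edge : finType := ({e : edge Gam | e != xy} + bool)%type.

Definition resolve_inc (v : vertex Gam) (e : resolve_edge) : bool :=
  match e with
  | inl f => inc v (val f)
  | inr true => v == x
  | inr false => v == y
  end.

Lemma resolve_ends_new b :
  [set v | resolve_inc v (inr b)] = [set (if b then x else y)].
Proof. by apply/setP => v; rewrite !inE /=; case: b. Qed.

Lemma resolve_le2 e : (#|[set v | resolve_inc v e]| <= 2)%N.
Proof.
case: e => [f|b]; first exact: (inc_le2 (val f)).
by rewrite resolve_ends_new cards1.
Qed.

Lemma resolve_inj e f : #|[set v | resolve_inc v e]| = 2%N ->
  [set v | resolve_inc v e] = [set v | resolve_inc v f] -> e = f.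
Proof.
case: e => [e|b]; last by rewrite resolve_ends_new cards1.
case: f => [f|b] he hef; last by rewrite hef resolve_ends_new cards1 in he.
by congr inl; apply/val_inj/inc_inj.
Qed.

Definition resolve : looseGraph := LooseGraph resolve_le2 resolve_inj.

End Resolution.

(* The point sets, over each field, of a subset of the projective space with  *)
(* homogeneous coordinates indexed by W, given by a condition on the          *)
(* coordinate vectors.                                                        *)
Definition locus (W : finType) := forall F : fieldType, {ffun W -> F} -> bool.

Section Loci.
Variable W : finType.
Implicit Types S T : locus W.

Definition locusI S T : locus W := fun F X => S F X && T F X.
Definition locusD S T : locus W := fun F X => S F X && ~~ T F X.

Definition proj_point (F : finFieldType) (X : {ffun W -> F}) :
  {set {ffun W -> F}} := [set [ffun w => a * X w] | a : F].

Definition points S (F : finFieldType) : {set {set {ffun W -> F}}} :=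
  [set proj_point X | X : {ffun W -> F} & (X != 0) && S F X].

Definition counts S (p : {poly int}) : Prop :=
  forall F : finFieldType, p.[#|F|%:R] = #|points S F|%:R.

(* The polynomial in the class 'X of the affine line whose value at q is the  *)
(* number of F_q-points, for all finite fields F_q. It exists for all loci    *)
(* obtained from loose graphs (classP, toric_scheme, toric_subscheme,         *)
(* toric_affine_at, toric_locusI, toric_locusD) and is unique                 *)
(* (counts_unique).                                                           *)
Definition class S : {poly int} := epsilon (inhabits 0) (counts S).

(* The locus X_v <> 0 and X_w = 0 for every w <> v outside N.                 *)
Definition cell (v : W) (N : {set W}) : locus W := fun F X =>
  (X v != 0) && [forall w, (w != v) && (w \notin N) ==> (X w == 0)].

End Loci.

Section SchemeOfLooseGraph.
Variable Gam : looseGraph.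

Definition affine_at (v : vertex Gam) : locus (vbar Gam) :=
  cell (inl v : vbar Gam) [set w | adjbar (inl v) w].

(* For an edge without vertices: the line through its two new vertices        *)
(* minus these two points.                                                    *)
Definition mult_group (e : edge Gam) : locus (vbar Gam) := fun F X =>
  [forall w, (X w != 0) == incbar w e].

Definition scheme : locus (vbar Gam) := fun F X =>
  [exists v, affine_at v X] ||
  [exists e, (ends e == set0) && mult_group e X].

Definition subscheme (L : subgraph Gam) : locus (vbar Gam) := fun F X =>
  [exists v in L.1,
    cell (inl v : vbar Gam)
         [set w | [exists e in L.2, inc v e && incbar w e]] X].

End SchemeOfLooseGraph.

Section Neighbourhood.
Variables (Gam : looseGraph) (x y : vertex Gam) (xy : edge Gam).

Definition Delta : subgraph Gam :=
  induced ((ball1 x :|: ball1 y) :\: [set x; y]).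

Definition Gxy : subgraph Gam :=
  induced ((ball1 x :&: ball1 y) :\: [set x; y]).

Definition GL : subgraph Gam :=
  (Gxy.1, [set e in Delta.2 | [exists v in Gxy.1, inc v e]]).

(* The two vertices u and v have to be the two ends of e: the vertices of     *)
(* Gxy lie in both balls, so that without u != v the second condition would   *)
(* be void.                                                                   *)
Definition GL_of (a b : vertex Gam) : subgraph Gam :=
  (Gxy.1, [set e in Delta.2 |
    [exists u in Gxy.1, exists v in ball1 a :\ b,
      [&& u != v, inc u e & inc v e]]]).

Definition GLx : subgraph Gam := GL_of x y.
Definition GLy : subgraph Gam := GL_of y x.

Definition coneGL : subgraph Gam :=
  ([set x; y] :|: Gxy.1,
   xy |: (GL.2 :|: [set e | [exists u in [set x; y], exists v in Gxy.1,
                              inc u e && inc v e]])).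

End Neighbourhood.

Section ClassExists.
Variable W : finType.
Implicit Types S T : locus W.

Definition nz (F : fieldType) (X : {ffun W -> F}) : {set W} :=
  [set w | X w != 0].

Definition toric S : Prop := exists K : {set {set W}},
  forall (F : fieldType) (X : {ffun W -> F}), S F X = (nz X \in K).

Lemma toric_locusI S T : toric S -> toric T -> toric (locusI S T).
Proof.
move=> [K hK] [K' hK']; exists (K :&: K') => F X.
by rewrite /locusI hK hK' inE.
Qed.

Lemma toric_locusD S T : toric S -> toric T -> toric (locusD S T).
Proof.
move=> [K hK] [K' hK']; exists (K :\: K') => F X.
by rewrite /locusD hK hK' inE andbC.
Qed.

Lemma cellE v N (F : fieldType) (X : {ffun W -> F}) :
  cell v N X = (v \in nz X) && (nz X \subset v |: N).
Proof.
rewrite /cell inE; congr andb; apply/forallP/subsetP => [h w|h w].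
- rewrite !inE => Xw; case: eqVneq => //= wv; apply: contraR Xw => wN.
  by move: (h w); rewrite wv wN.
- apply/implyP=> /andP[wv wN]; apply/contraT => Xw.
  by move: (h w); rewrite !inE Xw (negPf wv) (negPf wN) => /(_ isT).
Qed.

Section Count.
Variable F : finFieldType.
Implicit Types X Y : {ffun W -> F}.

Lemma proj_pointP X Y : X != 0 ->
  reflect (exists2 a, a != 0 & Y = [ffun w => a * X w])
          ((Y != 0) && (proj_point Y == proj_point X)).
Proof.
move=> X0; apply: (iffP andP) => [[Y0 /eqP YX]|[a a0 ->]].
- have: Y \in proj_point X.
    by rewrite -YX; apply/imsetP; exists 1 => //; apply/ffunP=> w;
       rewrite ffunE mul1r.
  case/imsetP=> a _ Ya; exists a => //; apply: contraNneq Y0 => a0.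
  by apply/eqP/ffunP => w; rewrite Ya a0 !ffunE mul0r.
- split.
    apply: contraNneq X0 => h; apply/eqP/ffunP=> w.
    have := congr1 (fun f : {ffun W -> F} => f w) h; rewrite !ffunE => /eqP.
    by rewrite mulf_eq0 (negPf a0) => /eqP.
  apply/eqP/setP => Z; apply/imsetP/imsetP => -[b _ ->].
    by exists (b * a) => //; apply/ffunP=> w; rewrite !ffunE mulrA.
  by exists (b / a) => //; apply/ffunP=> w; rewrite !ffunE mulrA divfK.
Qed.

Lemma card_ray X : X != 0 ->
  #|[set Y : {ffun W -> F} | (Y != 0) && (proj_point Y == proj_point X)]| = #|F|.-1.
Proof.
move=> X0; have inj : injective (fun a : F => [ffun w => a * X w]).
  move=> a b h; have [w Xw]: exists w, X w != 0.
    apply/existsP; apply: contraR X0 => /existsPn h0.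
    by apply/eqP/ffunP => w; rewrite ffunE; apply/eqP; rewrite -[_ == _]negbK.
  have := congr1 (fun f : {ffun W -> F} => f w) h; rewrite !ffunE.
  exact: mulIf.
rewrite -(cardC1 (0 : F)) -(card_imset _ inj); apply: eq_card => Y.
rewrite inE; apply/proj_pointP/imsetP => // -[a a0 ->]; exists a => //.
Qed.

Lemma card_nz (A : {set W}) : #|[set X : {ffun W -> F} | nz X == A]| =
  (#|F|.-1 ^ #|A|)%N.
Proof.
rewrite -(cardC1 (0 : F)) -(card_pffun_on (0 : F)); apply: eq_card => X.
rewrite inE; apply/eqP/pffun_onP => [<-|[sX hX]].
  split; first by apply/subsetP=> w; rewrite !inE.
  by move=> a /imageP[w]; rewrite !inE => Xw ->.
apply/setP=> w; rewrite !inE; apply/idP/idP => [Xw|wA].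
  by apply: (subsetP sX); rewrite inE.
by have := hX (X w) (image_f _ wA); rewrite inE.
Qed.

Lemma nz_eq0 X : (nz X == set0) = (X == 0).
Proof.
apply/eqP/eqP => [h|->]; last by apply/setP=> w; rewrite !inE ffunE eqxx.
by apply/ffunP=> w; have := in_set0 w; rewrite -h !inE ffunE => /negbFE/eqP.
Qed.

Lemma card_points S (K : {set {set W}}) :
  (forall X, S F X = (nz X \in K)) ->
  #|points S F| = (\sum_(A in K | A != set0) #|F|.-1 ^ #|A|.-1)%N.
Proof.
move=> hK; have q1 : (0 < #|F|.-1)%N by rewrite -subn1 subn_gt0 card_finNzRing_gt1.
apply/eqP; rewrite -(eqn_pmul2l q1) big_distrr /=; apply/eqP.
pose D := [set X : {ffun W -> F} | (X != 0) && S F X].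
transitivity #|D|.
  rewrite -[RHS]sum1_card (partition_big_imset (@proj_point W F)) /=.
  have -> : points S F = @proj_point W F @: D.
    by apply/setP=> p; apply/imsetP/imsetP => -[X hX ->]; exists X;
       rewrite ?inE // in hX *.
  rewrite mulnC -sum_nat_const; apply: eq_bigr => p /imsetP[X].
  rewrite inE => /andP[X0 SX] ->; rewrite sum1_card -(card_ray X0).
  apply: eq_card => Y; rewrite !inE unfold_in /= !inE.
  case: (boolP (Y != 0)) => //= Y0.
  case: (boolP (_ == _)) => [e|]; last by rewrite andbF.
  rewrite andbT; have /(proj_pointP _ X0)[a a0 ->] : 
    (Y != 0) && (proj_point Y == proj_point X) by rewrite Y0.
  move: SX; rewrite !hK; suff -> : nz [ffun w => a * X w] = nz X by [].
  by apply/setP => w; rewrite !inE ffunE mulf_eq0 (negPf a0).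
rewrite -sum1_card (partition_big (@nz F) [pred A in K | A != set0]) /=.
  apply: eq_bigr => A /andP[AK A0]; rewrite -expnS prednK ?card_gt0 //.
  rewrite -card_nz sum1_card; apply: eq_card => X; rewrite !inE unfold_in /= inE.
  by case: (eqVneq (nz X) A) => [h|]; rewrite ?andbF // andbT -nz_eq0 hK h AK A0.
by move=> X; rewrite inE hK nz_eq0 andbC.
Qed.

End Count.

Lemma classP S : toric S -> counts S (class S).
Proof.
move=> [K hK]; apply: epsilon_spec.
exists (\sum_(A in K | A != set0) ('X - 1) ^+ #|A|.-1) => F.
rewrite (card_points (hK F)) horner_sum natr_sum; apply: eq_bigr => A _.
rewrite horner_exp !hornerE natrX; congr (_ ^+ _).
by rewrite -subn1 natrB // ltnW // card_finNzRing_gt1.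
Qed.

Lemma counts_unique S p p' : counts S p -> counts S p' -> p = p'.
Proof.
move=> hp hp'; apply/eqP; rewrite -subr_eq0; apply: contraT => d0.
have sub : {mono (fun n : nat => n%:R : int) : m n / m == n}.
  by move=> m n; rewrite eqr_nat.
pose inf := fix f n := if n is m.+1 then s2val (prime_above (f m)) else 2%N.
have infP n : prime (inf n) by case: n => //= n; case: (prime_above _).
have inf_lt n : (inf n < inf n.+1)%N by rewrite /=; case: (prime_above _).
have inf_inj : injective inf.
  exact: incn_inj (leq_mono (homo_ltn ltn_trans inf_lt)).
pose s := [seq (inf n)%:R : int | n <- iota 0 (size (p - p'))].
have rs : all (root (p - p')) s.
  apply/allP=> _ /mapP[n _ ->]; rewrite rootE hornerD hornerN.
  have := hp 'F_(inf n); rewrite -(hp' 'F_(inf n)) card_Fp // => ->.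
  by rewrite subrr.
have us : uniq s.
  by rewrite map_inj_uniq ?iota_uniq // => m n /eqP; rewrite sub => /eqP /inf_inj.
by have := max_poly_roots d0 rs us; rewrite size_map size_iota ltnn.
Qed.

End ClassExists.

Section ToricLoci.
Variable Gam : looseGraph.

Lemma toric_affine_at (v : vertex Gam) : toric (affine_at v).
Proof.
exists [set A : {set vbar Gam} | (inl v \in A) && (A \subset inl v |: [set w | adjbar (inl v) w])].
by move=> F X; rewrite /affine_at cellE [RHS]in_set.
Qed.

Lemma toric_mult_group (e : edge Gam) : toric (mult_group e).
Proof.
exists [set [set w | incbar w e]] => F X; rewrite inE.
apply/forallP/eqP => [h|h w].
  by apply/setP=> w; rewrite !inE; exact: (eqP (h w)).
by have /setP/(_ w) := h; rewrite !inE => ->.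
Qed.

Lemma toric_exists (I W : finType) (P : pred I) (S : I -> locus W) :
  (forall i, toric (S i)) -> toric (fun F X => [exists i, P i && S i F X]).
Proof.
move=> h; pose K i := projT1 (constructive_indefinite_description _ (h i)).
have hK i F X : S i F X = (nz X \in K i).
  by rewrite /K; case: constructive_indefinite_description.
exists [set A : {set W} | [exists i, P i && (A \in K i)]] => F X; rewrite inE.
by apply: eq_existsb => i; rewrite hK.
Qed.

Lemma toric_scheme : toric (@scheme Gam).
Proof.
have [K hK] := toric_exists (fun _ => true) toric_affine_at.
have [K' hK'] := toric_exists (fun e => ends e == set0) toric_mult_group.
by exists (K :|: K') => F X; rewrite inE -hK -hK'.
Qed.

Lemma toric_subscheme (L : subgraph Gam) : toric (subscheme L).
Proof.
pose N v := [set w : vbar Gam | [exists e in L.2, inc v e && incbar w e]].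
apply: (toric_exists (fun v => v \in L.1) (S := fun v => cell (inl v) (N v))) => v.
exists [set A : {set vbar Gam} | (inl v \in A) && (A \subset inl v |: N v)].
by move=> F X; rewrite cellE [RHS]in_set.
Qed.

End ToricLoci.

(* Main.v *)
Require Import Defs.
From mathcomp Require Import all_boot all_order all_algebra.
From mathcomp Require Import ring.

Set Implicit Arguments.
Unset Strict Implicit.
Unset Printing Implicit Defensive.

Import GRing.Theory.
Local Open Scope ring_scope.

(** Whether a point lies in a locus attached to a loose graph depends only on its
    support, and a support [A] carries [(q - 1) ^ (#|A| - 1)] points.
    After multiplication by [L - 1], every class of the theorem is therefore
    the sum of [(L - 1) ^ #|A|] over its supports [A], and the identity becomes
    one between families of finite sets.

    The supports of [P(Gam)] are the sets contained in the closed star of one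
    of their vertices. Resolving [xy] keeps the stars of the vertices other
    than [x] and [y] and the number of neighbours of [x] and [y]; only the
    supports containing both [x] and [y] that are counted by more than one star
    are affected. Removing [x] and [y] from those supports leaves either a
    subset of [G] or a set contained in the star of a common neighbour. The
    supports on the right-hand side are sorted by their trace on [{x, y}] in
    the same way, and the components of [G^L] partition the remaining sets
    because two centres of the same support are joined by an edge. *)

(** * Generating sums over families of supports *)

Section SupportSum.
Variable W : finType.
Implicit Types (K B : {set {set W}}) (A N S T : {set W}) (c w : W).

(** The exponent is [#|A|] and not [#|A| - 1]: at q this counts coordinate vectors instead of
    projective points, so adjoining a coordinate is a plain product. *)
Definition support_sum K : {poly int} := \sum_(A in K) ('X - 1) ^+ #|A|.

Lemma support_sumID K B :
  support_sum K = support_sum (K :&: B) + support_sum (K :\: B).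
Proof. exact: big_setID. Qed.

Lemma support_sumU K B :
  support_sum (K :|: B) = support_sum K + support_sum B - support_sum (K :&: B).
Proof.
rewrite (support_sumID (K :|: B) K) setUK setDUl setDv set0U.
rewrite (support_sumID B K) [B :&: K]setIC; ring.
Qed.

Lemma support_sumD_sub K B : B \subset K ->
  support_sum (K :\: B) = support_sum K - support_sum B.
Proof.
move=> /setIidPr BK.
by rewrite (support_sumID K B) BK [RHS]addrAC subrr add0r.
Qed.

Lemma support_sum0 : support_sum set0 = 0.
Proof. exact: big_set0. Qed.

(** Adjoining [c] is injective on [B] and raises every cardinality by one, because no member of [B]
    contains [c]. *)
Lemma support_sum_add c B : (forall A, A \in B -> c \notin A) ->
  support_sum [set A : {set W} | (c \in A) && (A :\ c \in B)] = ('X - 1) * support_sum B.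
Proof.
move=> cB.
have -> : [set A : {set W} | (c \in A) && (A :\ c \in B)] =
          [set c |: (A : {set W}) | A in B].
  apply/setP => A; rewrite inE; apply/andP/imsetP => [[cA AB]|[A' A'B ->]].
    by exists (A :\ c) => //; rewrite setD1K.
  by rewrite setU11 setU1K ?cB.
rewrite /support_sum big_imset /= => [|A A' AB A'B h]; last first.
  by rewrite -[A](setU1K (cB _ AB)) h setU1K ?cB.
by rewrite mulr_sumr; apply: eq_bigr => A AB; rewrite cardsU1 cB // exprS.
Qed.

(** The coordinate at [c] is free: supports with [c] contribute the factor ['X - 1], those without
    it the factor 1. *)
Lemma support_sum_del c B : (forall A, A \in B -> c \notin A) ->
  support_sum [set A : {set W} | A :\ c \in B] = 'X * support_sum B.
Proof.
move=> cB; pose C := [set A : {set W} | c \in A].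
rewrite (support_sumID _ C).
have -> : [set A : {set W} | A :\ c \in B] :&: C =
          [set A : {set W} | (c \in A) && (A :\ c \in B)].
  by apply/setP => A; rewrite !inE andbC.
have -> : [set A : {set W} | A :\ c \in B] :\: C = B.
  apply/setP => A; rewrite !inE; case: (boolP (c \in A)) => cA /=.
    by apply/esym/negP => /cB; rewrite cA.
  suff -> : A :\ c = A by [].
  by apply/setDidPl; rewrite disjoint_sym disjoints1.
rewrite support_sum_add //; ring.
Qed.

(** The sum with exponents [#|A|.-1] has the right value at every q, so it is the class by
    uniqueness of the counting polynomial. Excluding the empty support makes the predecessor
    exact. *)
Lemma support_sum_supports (S : locus W) K :
    (forall (F : fieldType) (X : {ffun W -> F}), S F X = (nz X \in K)) ->
    set0 \notin K ->
  ('X - 1) * class S = support_sum K.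
Proof.
move=> hK K0; have -> : class S = \sum_(A in K) ('X - 1) ^+ #|A|.-1.
  have tS : toric S by exists K.
  apply: counts_unique (classP tS) _ => F.
  rewrite (card_points (hK F)) horner_sum natr_sum [RHS]big_mkcondr /=.
  apply: eq_bigr => A AK; rewrite (memPn K0) //.
  rewrite horner_exp !hornerE natrX; congr (_ ^+ _).
  by rewrite -subn1 natrB // ltnW // card_finNzRing_gt1.
rewrite mulr_sumr; apply: eq_bigr => A AK; rewrite -exprS prednK //.
by rewrite card_gt0 (memPn K0).
Qed.

Definition cell_supports c N := [set A : {set W} | (c \in A) && (A \subset c |: N)].

Lemma cell_supportsE c N (F : fieldType) (X : {ffun W -> F}) :
  cell c N X = (nz X \in cell_supports c N).
Proof. by rewrite cellE [RHS]inE. Qed.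

Lemma support_sum_bigcup (I : finType) (P : {set I}) (K : I -> {set {set W}}) :
    (forall i j, i \in P -> j \in P -> i != j -> [disjoint K i & K j]) ->
  support_sum (\bigcup_(i in P) K i) = \sum_(i in P) support_sum (K i).
Proof.
move=> dis; rewrite /support_sum.
under [RHS]eq_bigr do rewrite big_mkcond /=.
rewrite exchange_big /= big_mkcond /=; apply: eq_bigr => A _.
case: ifPn => [/bigcupP[i iP Ai]|/bigcupP AK].
  rewrite (bigD1 i) //= Ai big1 ?addr0 // => j /andP[jP ji].
  by rewrite (disjointFl (dis j i jP iP ji)).
by rewrite big1 // => i iP; case: ifPn => // Ai; case: AK; exists i.
Qed.

End SupportSum.

(** Each member of [K'] is the image of its preimage. This serves to pull the supports of the
    resolved graph back to [Gam]. *)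
Lemma support_sum_preim (W W' : finType) (f : W -> W') (K' : {set {set W'}}) :
    injective f -> (forall A, A \in K' -> A \subset codom f) ->
  support_sum K' = support_sum [set A : {set W} | f @: A \in K'].
Proof.
move=> f_inj K'f; pose K := [set A : {set W} | f @: A \in K'].
have -> : K' = [set f @: (A : {set W}) | A in K].
  apply/setP => A'; apply/idP/imsetP => [A'K|[A]]; last by rewrite inE => ? ->.
  have e : f @: (f @^-1: A') = A'.
    apply/setP => w'; apply/imsetP/idP => [[w]|w'A]; first by rewrite inE => ? ->.
    have /subsetP/(_ _ w'A)/codomP[w ew] := K'f _ A'K.
    by exists w; rewrite // inE -ew.
  by exists (f @^-1: A'); rewrite ?inE e.
rewrite [LHS]/support_sum big_imset /=; last by move=> ? ? _ _; apply: imset_inj.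
have -> : [set A : {set W} | f @: A \in [set f @: (A : {set W}) | A in K]] = K.
  by apply/setP => A; rewrite inE mem_imset //; apply: imset_inj.
by apply: eq_bigr => A _; rewrite card_imset.
Qed.

(** * Supports of the loci attached to a loose graph *)

Section LooseGraphSupports.
Variable Gam : looseGraph.
Implicit Types (u v : vertex Gam) (e : edge Gam) (w : vbar Gam).
Implicit Types (A S T : {set vbar Gam}) (L : subgraph Gam).

Definition star v : {set vbar Gam} := inl v |: [set w | adjbar (inl v) w].

Definition star_supports v : {set {set vbar Gam}} :=
  [set A : {set vbar Gam} | (inl v \in A) && (A \subset star v)].

Definition scheme_supports : {set {set vbar Gam}} := \bigcup_v star_supports v.

Definition subgraph_supports L : {set {set vbar Gam}} :=
  \bigcup_(v in L.1) cell_supports (inl v)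
                       [set w | [exists e in L.2, inc v e && incbar w e]].

Lemma in_star w v :
  (w \in star v) = (w == inl v) || [exists e, inc v e && incbar w e].
Proof. by rewrite !inE /adjbar eq_sym; case: eqVneq. Qed.

Lemma star_refl v : inl v \in star v.
Proof. exact: setU11. Qed.

Lemma star_inl u v : (inl u \in star v) = (u \in ball1 v).
Proof.
rewrite in_star inE /adj [v == u]eq_sym.
have -> : (inl u == inl v :> vbar Gam) = (u == v) by [].
by case: eqVneq.
Qed.

Lemma star_inr v (s : {e : edge Gam & 'I_(2 - #|ends e|)}) :
  (inr s \in star v) = inc v (tag s).
Proof.
rewrite in_star /=; apply/existsP/idP => [[e /andP[ve /eqP->]] //|vs].
by exists (tag s); rewrite vs eqxx.
Qed.

Lemma ball1_sym u v : (u \in ball1 v) = (v \in ball1 u).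
Proof.
rewrite !inE /adj [v == u]eq_sym; congr (_ || _ && _).
by apply: eq_existsb => e; rewrite andbC.
Qed.

Lemma ends_eq2 u v e : u != v -> inc u e -> inc v e -> ends e = [set u; v].
Proof.
move=> uv ue ve; apply/esym/eqP; rewrite eqEcard cards2 uv inc_le2 andbT.
by apply/subsetP => z; rewrite !inE => /orP[] /eqP->.
Qed.

Lemma edge_unique u v e f :
  u != v -> inc u e -> inc v e -> inc u f -> inc v f -> e = f.
Proof.
move=> uv ue ve uf vf; have he := ends_eq2 uv ue ve.
by apply: inc_inj; rewrite -!/(ends _) he ?cards2 ?uv ?(ends_eq2 uv uf vf).
Qed.

(** Rules out new vertices on an edge with two vertices, where the index type is ['I_0]. *)
Lemma ordinal_ends_void e : #|ends e| = 2%N -> 'I_(2 - #|ends e|) -> False.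
Proof. by move=> ->; case. Qed.

(* A new vertex is adjacent to at most one vertex, so it is in no second star. *)
Lemma star_common u v w : u != v -> w \in star u -> w \in star v ->
  exists2 z, w = inl z & (z \in ball1 u) && (z \in ball1 v).
Proof.
case: w => [z|[e i]] uv; first by rewrite !star_inl => zu zv; exists z => //; rewrite zu.
rewrite !star_inr /= => ue ve; case: (@ordinal_ends_void e) => //.
by rewrite (ends_eq2 uv ue ve) cards2 uv.
Qed.

Lemma subgraph_supports_nz L (F : fieldType) (X : {ffun vbar Gam -> F}) :
  subscheme L X = (nz X \in subgraph_supports L).
Proof.
apply/existsP/bigcupP => [[v /andP[vL h]]|[v vL h]]; exists v => //.
  by rewrite -cell_supportsE.
by rewrite vL cell_supportsE.
Qed.

Lemma class_subscheme L :
  ('X - 1) * class (subscheme L) = support_sum (subgraph_supports L).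
Proof.
apply: support_sum_supports => [F X|]; first exact: subgraph_supports_nz.
by apply/bigcupP => -[v _]; rewrite inE in_set0.
Qed.

(** If every edge has a vertex, there is no multiplicative group and the affine pieces alone make up
    the scheme. *)
Lemma class_scheme : (forall e, ends e != set0) ->
  ('X - 1) * class (@scheme Gam) = support_sum scheme_supports.
Proof.
move=> e0; apply: support_sum_supports => [F X|].
  rewrite /scheme orbC; case: existsP => [[e]|_] /=; first by rewrite (negPf (e0 e)).
  apply/existsP/bigcupP => [[v h]|[v _ h]]; exists v => //.
    by rewrite [_ \in _]inE -cellE.
  by rewrite /affine_at cellE; rewrite [_ \in _]inE in h.
by apply/bigcupP => -[v _]; rewrite inE in_set0.
Qed.

(** A path from [e] to the vertex [v] has to leave [e] through one of its vertices. *)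
Lemma connected_ends v e : connected Gam -> ends e != set0.
Proof.
move=> hc; have /connectP[[|z p] //= /andP[h _] _] := hc (inr e) (inl v).
case: z h => [u|f]; rewrite /incidence ?andbF // => /and3P[_ _ ue].
by apply/set0Pn; exists u; rewrite inE.
Qed.

End LooseGraphSupports.

(** * Decomposition over connected components *)

Section Components.
Variable Gam : looseGraph.
Implicit Types (L : subgraph Gam) (A : {set vbar Gam}).

Lemma subgraph_supportsP L A :
  reflect (exists v, [/\ v \in L.1, inl v \in A & forall w, w \in A ->
             w != inl v -> exists e, [/\ e \in L.2, inc v e & incbar w e]])
          (A \in subgraph_supports L).
Proof.
apply: (iffP bigcupP) => [[v vL]|[v [vL vA hA]]]; last exists v => //.
  rewrite inE => /andP[vA /subsetP AN]; exists v; split=> // w wA wv.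
  move: (AN w wA); rewrite in_setU1 (negPf wv) inE => /existsP[e].
  by case/and3P=> eL ve we; exists e.
rewrite inE vA; apply/subsetP => w wA; rewrite in_setU1 inE.
have [//|wv /=] := eqVneq; have [e [eL ve we]] := hA w wA wv.
by apply/existsP; exists e; rewrite eL ve.
Qed.

Lemma connect_incidence_sym L : connect_sym (incidence L).
Proof.
apply: sym_connect_sym => z t; rewrite /incidence andbCA.
by case: z t => [u|e] [v|f].
Qed.

Lemma component_eq L z t :
  connect (incidence L) z t -> component L z = component L t.
Proof.
move=> zt; rewrite /component.
by congr pair; apply/setP => c;
   rewrite !inE (same_connect (@connect_incidence_sym L) zt).
Qed.

Lemma connect_inc L v e : v \in L.1 -> e \in L.2 -> inc v e ->
  connect (incidence L) (inl v) (inr e).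
Proof. by move=> vL eL ve; apply: connect1; rewrite /incidence !inE vL eL. Qed.

(** Every edge used by a support is incident with its centre, so the support belongs to the
    component of that centre in [L]. Allowing a smaller edge set in [L'] covers [GLx] and [GLy] with
    the components of [GL]. *)
Lemma subgraph_supports_components L L' : L'.1 = L.1 -> L'.2 \subset L.2 ->
  support_sum (subgraph_supports L') =
  \sum_(C in components L) support_sum (subgraph_supports (subgraphI C L')).
Proof.
move=> L1 /subsetP L2; rewrite -support_sum_bigcup.
  congr support_sum; apply/setP => A; apply/idP/bigcupP => [|[C _]].
    case/subgraph_supportsP => v [vL vA hA]; exists (component L (inl v)).
      by apply/imsetP; exists (inl v); rewrite // inE -L1.
    apply/subgraph_supportsP; exists v; split=> //.
      by rewrite !inE -L1 vL connect0.
    move=> w wA /(hA w wA)[e [eL ve we]]; exists e; split=> //.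
    by rewrite !inE L2 // eL connect_inc // ?L2 // -L1.
  case/subgraph_supportsP => v [/setIP[_ vL] vA hA].
  apply/subgraph_supportsP; exists v; split=> // w wA /(hA w wA)[e].
  by case=> /setIP[_ eL] ve we; exists e.
(* Disjointness: two centres of one support are equal or joined by an edge, hence lie in the same
   component. *)
move=> _ _ /imsetP[z _ ->] /imsetP[t _ ->]; apply: contraNT.
case/pred0Pn => A /andP[/= /subgraph_supportsP[v [vC vA hA]]].
case/subgraph_supportsP => u [uC uA _].
move: vC uC; rewrite !inE => /andP[/andP[vL zv] _] /andP[/andP[uL tu] _].
apply/eqP; rewrite (component_eq zv) (component_eq tu).
have [[->] //|uv] := eqVneq (inl u : vbar Gam) (inl v).
have [e [/setIP[_ /L2 eL] ve /= ue]] := hA _ uA uv.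
apply/component_eq/(connect_trans (connect_inc vL eL ve)).
by rewrite connect_incidence_sym connect_inc.
Qed.

Lemma subgraphI_component L C : C \in components L -> subgraphI C L = C.
Proof.
case/imsetP => z _ ->; congr pair; apply/setIidPl/subsetP => c;
  by rewrite inE => /andP[].
Qed.

End Components.

(** * Supports contained in a star *)

Section StarSupports.
Variable Gam : looseGraph.
Implicit Types (u v x y : vertex Gam) (c w : vbar Gam) (A : {set vbar Gam}).

Definition star_supports_wo v c : {set {set vbar Gam}} :=
  [set A : {set vbar Gam} | (inl v \in A) && (A \subset star v :\ c)].

(** Splitting off the free coordinate at a neighbour [c] allows stars with different neighbours to
    be compared. *)
Lemma support_sum_star v c : c \in star v -> c != inl v ->
  support_sum (star_supports v) = 'X * support_sum (star_supports_wo v c).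
Proof.
move=> cv c_v; rewrite -(@support_sum_del _ c) => [|A]; last first.
  rewrite inE => /andP[_ /subsetP h]; apply/negP => /h.
  by rewrite !inE eqxx.
congr support_sum; apply/setP => A; rewrite !inE [inl v == c]eq_sym c_v /=.
congr andb; apply/subsetP/subsetP => h w.
  by rewrite !inE => /andP[-> /h]; rewrite !inE.
move=> wA; have [->//|wc] := eqVneq w c.
by have := h w; rewrite !in_setD1 wc wA => /(_ isT).
Qed.

Definition other_supports x y : {set {set vbar Gam}} :=
  \bigcup_(v in ~: [set x; y]) star_supports v.

Lemma scheme_supports_split x y : scheme_supports Gam =
  (star_supports x :|: star_supports y) :|: other_supports x y.
Proof.
apply/setP => A; rewrite !in_setU; apply/bigcupP/idP => [[v _ Av]|].
  have [<-|vx] := eqVneq v x; first by rewrite Av.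
  have [<-|vy] := eqVneq v y; first by rewrite Av orbT.
  by apply/orP; right; apply/bigcupP; exists v; rewrite // !inE negb_or vx.
case/orP => [/orP[]|/bigcupP[v _]] hA; [by exists x|by exists y|by exists v].
Qed.

End StarSupports.

(** * Effect of the resolution on supports *)

Section ResolveSupports.
Variables (Gam : looseGraph) (x y : vertex Gam) (xy : edge Gam).
Hypotheses (x_neq_y : x != y) (x_xy : inc x xy) (y_xy : inc y xy).

Let R : looseGraph := resolve x y xy.
(** The Booleans agree with the tags of the two new edges, so both ends of [xy] can be treated at
    once. *)
Let xyE (b : bool) : vertex Gam := if b then x else y.

Let xyE_neq b : xyE b != xyE (~~ b).
Proof. by case: b => //=; rewrite eq_sym. Qed.

Let xyE_inc b : inc (xyE b) xy. Proof. by case: b. Qed.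

Let resolve_inc_new b (v : vertex R) : inc v (inr b : edge R) = (v == xyE b).
Proof. by case: b. Qed.

(* The value [inl x] is junk: both vertices of [xy] lie in [Gam], so no new
   vertex belongs to [xy]. *)
Definition vbar_resolve (w : vbar Gam) : vbar R :=
  match w with
  | inl v => inl (v : vertex R)
  | inr (existT e i) =>
    match boolP (e != xy) with
    | AltTrue h => inr (existT _ (inl (exist _ e h) : edge R) i)
    | AltFalse _ => inl (x : vertex R)
    end
  end.

Let xy_void (i : 'I_(2 - #|ends xy|)) : False.
Proof.
by apply: (@ordinal_ends_void _ xy) i; rewrite (ends_eq2 x_neq_y) ?cards2 ?x_neq_y.
Qed.

Lemma vbar_resolve_inr e (i : 'I_(2 - #|ends e|)) (h : e != xy) :
  vbar_resolve (inr (existT _ e i)) = inr (existT _ (inl (exist _ e h) : edge R) i).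
Proof.
rewrite /=; case: {-}_ / (boolP (e != xy)) => h'; last by rewrite h in h'.
by rewrite (bool_irrelevance h' h).
Qed.

Lemma vbar_resolve_cases (w : vbar Gam) :
  (exists2 v, w = inl v & vbar_resolve w = inl (v : vertex R)) \/
  exists e (i : 'I_(2 - #|ends e|)) (h : e != xy), w = inr (existT _ e i) /\
    vbar_resolve w = inr (existT _ (inl (exist _ e h) : edge R) i).
Proof.
case: w => [v|[e i]]; [by left; exists v | right].
have [exy|h] := eqVneq e xy; first by case: xy_void; rewrite -exy.
by exists e, i, h; rewrite vbar_resolve_inr.
Qed.

(** Only a left inverse of [vbar_resolve]: the value [inl x] on the new vertices is arbitrary. *)
Definition resolve_vbar (w : vbar R) : vbar Gam :=
  match w with
  | inl v => inl (v : vertex Gam)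
  | inr (existT (inl f) i) => inr (existT _ (val f) i)
  | inr (existT (inr _) _) => inl x
  end.

Lemma vbar_resolveK : cancel vbar_resolve resolve_vbar.
Proof.
by move=> w; case: (vbar_resolve_cases w) => [[v -> ->]|[e [i [h [-> ->]]]]].
Qed.

Let card_ends_new b : (2 - #|ends (inr b : edge R)|)%N = 1%N.
Proof. by rewrite [ends _](resolve_ends_new x y xy b) cards1. Qed.

(** The loose edge [inr b] lacks exactly one end, so the cast of the element of ['I_1] is its only
    index. *)
Definition new_vertex (b : bool) : vbar R :=
  inr (existT _ (inr b : edge R) (cast_ord (esym (card_ends_new b)) ord0)).

Lemma vbar_resolve_codom (w : vbar R) :
  (w \in codom vbar_resolve) || [exists b, w == new_vertex b].
Proof.
case: w => [v|[[[e h]|b] i]].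
- by apply/orP; left; apply/codomP; exists (inl v).
- apply/orP; left; apply/codomP; exists (inr (existT _ e i)).
  by rewrite vbar_resolve_inr.
apply/orP; right; apply/existsP; exists b; apply/eqP; congr (inr (existT _ _ _)).
by apply/val_inj => /=; case: i => -[|i] //= hi; move: (hi); rewrite card_ends_new.
Qed.

Lemma new_vertex_star b (v : vertex R) : (new_vertex b \in star v) = (v == xyE b).
Proof. rewrite star_inr; exact: resolve_inc_new. Qed.

(** Resolution only removes the adjacency of [x] and [y]; the negated existential says that [v] and
    [w] are not the two ends of [xy]. *)
Lemma vbar_resolve_star (v : vertex Gam) (w : vbar Gam) :
  (vbar_resolve w \in star (v : vertex R)) =
  (w \in star (v : vertex Gam)) && ~~ [exists b, (v == xyE b) && (w == inl (xyE (~~ b)))].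
Proof.
case: (vbar_resolve_cases w) => [[u -> ->]|[e [i [h [-> ->]]]]]; last first.
  rewrite !star_inr /=; case: (inc v e) => //=; apply/esym/existsPn => b.
  by rewrite andbF.
rewrite !in_star.
have -> : (inl u == inl v :> vbar R) = (u == v) by [].
have -> : (inl u == inl v :> vbar Gam) = (u == v) by [].
have [->|uv] /= := eqVneq.
  apply/esym/existsPn => b; apply/negP => /andP[/eqP-> /eqP[]].
  by apply/eqP.
apply/existsP/andP => [[[[f f_xy]|b] /andP[]]|[/existsP[e /andP[ve ue]] /existsPn h]].
- move=> /= vf uf; split; first by apply/existsP; exists f; rewrite vf.
  (* A surviving edge joining [x] and [y] would be [xy], as there are no parallel edges. *)
  apply/existsPn => b; apply/negP => /andP[/eqP eqv /eqP[equ]].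
  move: f_xy; rewrite (edge_unique uv uf vf (f := xy)) ?eqxx // ?equ ?eqv //.
- move=> vb ub; move/eqP: uv; case.
  by rewrite (eqP (etrans (esym (resolve_inc_new b u)) ub))
             (eqP (etrans (esym (resolve_inc_new b v)) vb)).
(* If [e] were [xy], then [u] and [v] would be its two ends, which [h] excludes. *)
have e_xy : e != xy.
  apply: contraTneq ue => eqe; apply/negP => ue; rewrite eqe in ve ue.
  have := ends_eq2 x_neq_y x_xy y_xy.
  move/setP => hE; move: (hE u) (hE v); rewrite !inE ue ve.
  case/esym/orP => /eqP eu; case/esym/orP => /eqP ev;
    rewrite eu ev ?eqxx // in uv h.
    by have := h false; rewrite /= !eqxx.
  by have := h true; rewrite /= !eqxx.
by exists (inl (exist _ e e_xy)); rewrite /= ve.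
Qed.

Let vbar_resolve_inj : injective vbar_resolve := can_inj vbar_resolveK.

Let imset_star (v : vertex Gam) (A : {set vbar Gam}) :
  (vbar_resolve @: A \in star_supports (v : vertex R)) =
  (inl v \in A) && (A \subset vbar_resolve @^-1: star (v : vertex R)).
Proof.
rewrite inE -sub_imset_pre; congr andb.
exact: (mem_imset A (inl v) vbar_resolve_inj).
Qed.

Let preim_star_other v : v \in ~: [set x; y] ->
  vbar_resolve @^-1: star (v : vertex R) = star (v : vertex Gam).
Proof.
rewrite !inE negb_or => /andP[/negPf vx /negPf vy]; apply/setP => w.
rewrite in_set vbar_resolve_star; case: existsP => [[b]|_]; last exact: andbT.
by case: b; rewrite /= ?vx ?vy.
Qed.

Let preim_star b : vbar_resolve @^-1: star (xyE b : vertex R) =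
  star (xyE b : vertex Gam) :\ inl (xyE (~~ b)).
Proof.
apply/setP => w; rewrite in_setD1 in_set vbar_resolve_star andbC; congr (~~ _ && _).
apply/existsP/eqP => [[c /andP[/eqP e /eqP->]]|->]; last by exists b; rewrite !eqxx.
have [-> //|cb] := eqVneq c b; have eqc : c = ~~ b by case: (c) (b) cb => -[].
by case/eqP: (xyE_neq b); rewrite e eqc.
Qed.

(** The two new vertices lie only in the stars of [x] and [y]. *)
Let other_codom (A : {set vbar R}) :
  A \in @other_supports R x y -> A \subset codom vbar_resolve.
Proof.
case/bigcupP => v; rewrite !inE negb_or => /andP[/negPf vx /negPf vy].
case/andP => _ /subsetP Av; apply/subsetP => w /Av wv.
have /orP[//|/existsP[b /eqP ew]] := vbar_resolve_codom w.
by move: wv; rewrite ew new_vertex_star; case: b {ew}; rewrite /= ?vx ?vy.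
Qed.

Let other_preim (A : {set vbar Gam}) :
  (vbar_resolve @: A \in @other_supports R x y) = (A \in @other_supports Gam x y).
Proof.
by apply/bigcupP/bigcupP => -[v v_xy Av]; exists v => //;
  move: Av; rewrite imset_star (preim_star_other v_xy) inE.
Qed.

(** Splitting off the other end of [xy] in [Gam], and the new vertex in [R], leaves corresponding
    supports and the same factor ['X]. *)
Let support_sum_star_resolve b :
  support_sum (star_supports (xyE b : vertex R)) =
  support_sum (star_supports (xyE b : vertex Gam)).
Proof.
rewrite (@support_sum_star _ _ (new_vertex b)) ?new_vertex_star ?eqxx //.
rewrite (@support_sum_star _ _ (inl (xyE (~~ b)))); last first.
- by apply/eqP => -[e]; move: (xyE_neq b); rewrite e eqxx.
- by rewrite in_star; apply/orP; right; apply/existsP; exists xy; rewrite /= !xyE_inc.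
congr (_ * _); rewrite (support_sum_preim vbar_resolve_inj) => [|A].
  congr support_sum; apply/setP => A; rewrite !inE sub_imset_pre preimsetD preim_star.
  (* New vertices are outside the image, so removing one has no effect on a preimage. *)
  have -> : forall S : {set vbar Gam},
      S :\: vbar_resolve @^-1: [set new_vertex b] = S; last first.
    congr andb; exact: (mem_imset A (inl (xyE b))).
  move=> S.
  apply/setDidPl; rewrite disjoint_sym; apply/pred0P => w /=; rewrite !inE.
  by apply/andP => -[/eqP]; case: (vbar_resolve_cases w) => [[v _ ->]|[e [i [h [_ ->]]]]].
(* The new vertex of this edge has been removed, and that of the other loose edge is not in this
   star. *)
rewrite inE => /andP[_ /subsetP h]; apply/subsetP => w /h; rewrite in_setD1.
have /orP[//|/existsP[c /eqP ew]] := vbar_resolve_codom w.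
rewrite ew new_vertex_star => /andP[cb /eqP e]; case/eqP: cb.
congr new_vertex; apply/eqP; apply: contraNT (xyE_neq b) => cb.
suff -> : ~~ b = c by rewrite e.
by case: (c) (b) cb => -[].
Qed.

Let two_stars : {set {set vbar Gam}} := star_supports x :|: star_supports y.

Let two_stars_resolve : {set {set vbar R}} :=
  star_supports (x : vertex R) :|: star_supports (y : vertex R).

(** In [R] the vertices [x] and [y] are no longer adjacent, so no support centred at [y] contains
    [x]. *)
Let star_resolve_disjoint :
  star_supports (x : vertex R) :&: star_supports (y : vertex R) = set0.
Proof.
apply/setP => A; rewrite in_set0; apply/negP; rewrite inE.
case/andP; rewrite !inE => /andP[xA _] /andP[_ /subsetP/(_ _ xA)].
rewrite [_ \in _](vbar_resolve_star y (inl x)).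
case/andP => _ /existsP[]; exists false.
by rewrite /= !eqxx.
Qed.

Let both : {set {set vbar Gam}} :=
  [set A : {set vbar Gam} | (inl x \in A) && (inl y \in A)].

(** A support centred at [x] or [y] in [R] omits the other of the two, so the surviving overlaps are
    those of [Gam] that do not contain both. *)
Let two_stars_other_resolve :
  support_sum (two_stars_resolve :&: @other_supports R x y) =
  support_sum (two_stars :&: @other_supports Gam x y :\: both).
Proof.
rewrite (support_sum_preim vbar_resolve_inj) => [|A /setIP[_ /other_codom] //].
congr support_sum; apply/setP => A; rewrite in_set in_setI other_preim.
rewrite in_setD in_setI andbA; congr andb.
rewrite in_setU !imset_star (preim_star true) (preim_star false) /=.
rewrite !inE /= !subsetD1.
by case: (inl x \in A); case: (inl y \in A); rewrite /= ?andbF ?andbT ?orbF.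
Qed.

(** Inclusion and exclusion on both sides: the single stars, the other stars and the overlaps
    missing [x] or [y] cancel. *)
Lemma support_sum_resolve :
  support_sum (scheme_supports Gam) - support_sum (scheme_supports R) =
  - support_sum (star_supports x :&: star_supports y)
  - support_sum ((star_supports x :|: star_supports y) :&:
                 other_supports x y :&: both).
Proof.
rewrite (scheme_supports_split x y) (@scheme_supports_split R x y).
rewrite !(support_sumU (_ :|: _)) two_stars_other_resolve.
rewrite !(support_sumU (star_supports _)) star_resolve_disjoint support_sum0.
rewrite (support_sum_star_resolve true) (support_sum_star_resolve false).
rewrite [support_sum (@other_supports R x y)](support_sum_preim vbar_resolve_inj) //.
have -> : [set A : {set vbar Gam} | vbar_resolve @: A \in @other_supports R x y] =
          other_supports x y by apply/setP => A; rewrite inE other_preim.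
rewrite (support_sumID (two_stars :&: other_supports x y) both).
rewrite -/two_stars /=; ring.
Qed.

End ResolveSupports.

(** * Adjoining two coordinates to supports *)

Section TwoPoints.
Variables (W : finType) (c d : W) (Q : {set {set W}}).
Hypotheses (c_neq_d : c != d)
  (cQ : forall B : {set W}, B \in Q -> c \notin B)
  (dQ : forall B : {set W}, B \in Q -> d \notin B).

Let cQd (A : {set W}) : A \in [set A : {set W} | A :\ d \in Q] -> c \notin A.
Proof. by rewrite inE => /cQ; rewrite in_setD1 c_neq_d. Qed.

(** Both coordinates are free here. In the two variants that follow, [c] alone or both must be
    nonzero, which turns a factor ['X] into ['X - 1]. *)
Lemma support_sum_del2 :
  support_sum [set A : {set W} | A :\: [set c; d] \in Q] = 'X ^+ 2 * support_sum Q.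
Proof.
rewrite expr2 -mulrA -(support_sum_del dQ) -(support_sum_del cQd).
by congr support_sum; apply/setP => A; rewrite !inE setDDl.
Qed.

Lemma support_sum_add_del :
  support_sum [set A : {set W} | (c \in A) && (A :\: [set c; d] \in Q)] =
  ('X - 1) * ('X * support_sum Q).
Proof.
rewrite -(support_sum_del dQ) -(support_sum_add cQd).
by congr support_sum; apply/setP => A; rewrite !inE setDDl.
Qed.

Lemma support_sum_add2 :
  support_sum [set A : {set W} |
    [&& c \in A, d \in A & A :\: [set c; d] \in Q]] =
  ('X - 1) ^+ 2 * support_sum Q.
Proof.
rewrite expr2 -mulrA -(support_sum_add dQ) -(@support_sum_add _ c) => [|A]; last first.
  by rewrite inE => /andP[_ /cQ]; rewrite in_setD1 c_neq_d.
congr support_sum; apply/setP => A.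
by rewrite !inE setDDl [d == c]eq_sym (negPf c_neq_d).
Qed.

End TwoPoints.

(** * Supports near the edge [xy] *)

Section NeighbourhoodSupports.
Variables (Gam : looseGraph) (x y : vertex Gam) (xy : edge Gam).
Hypotheses (x_neq_y : x != y) (x_xy : inc x xy) (y_xy : inc y xy).
Implicit Types (a b u v : vertex Gam) (e : edge Gam) (w : vbar Gam).
Implicit Types (A B : {set vbar Gam}) (T : {set vertex Gam}).

Let XY : {set vbar Gam} := [set inl x; inl y].
Let G : {set vertex Gam} := (Gxy x y).1.
Let D : {set vertex Gam} := (Delta x y).1.
Let N a : {set vertex Gam} := ball1 a :\: [set x; y].

Let inl_inj : injective (@inl (vertex Gam) {e : edge Gam & 'I_(2 - #|ends e|)}).
Proof. by move=> u v []. Qed.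

Definition inl_set T : {set vbar Gam} := [set inl v | v in T].

Lemma in_inl_set u T : (inl u \in inl_set T) = (u \in T).
Proof. exact: (mem_imset T u inl_inj). Qed.

Lemma inl_setS T T' : T \subset T' -> inl_set T \subset inl_set T'.
Proof. exact: imsetS. Qed.

(* For [T] = the vertices of [Delta], [ball1 x] or [ball1 y] minus [x] and [y],
   and the vertices of [G], these are the supports of G^L, G^L_x, G^L_y, G. *)
Definition common_supports T : {set {set vbar Gam}} :=
  [set B : {set vbar Gam} |
    [exists v in G, B \in star_supports v] && (B \subset inl_set T)].

(* Obtained from the cone over G^L, and from its parts in the affine spaces at
   [x] and at [y], by removing [x] and [y] from the supports that meet them. *)
Definition join_supports T : {set {set vbar Gam}} :=
  powerset (inl_set G) :|: common_supports T.

Let in_G u : (u \in G) = (u \in N x) && (u \in N y).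
Proof. by rewrite !inE; case: (u == x); case: (u == y). Qed.

Let in_D u : (u \in D) = (u \in N x) || (u \in N y).
Proof. by rewrite !inE; case: (u == x); case: (u == y). Qed.

Let N_D a : a \in [set x; y] -> N a \subset D.
Proof.
by rewrite !inE => /orP[] /eqP->; apply/subsetP => u; rewrite in_D => ->; rewrite ?orbT.
Qed.

Let G_N a : a \in [set x; y] -> G \subset N a.
Proof.
by rewrite !inE => /orP[] /eqP->; apply/subsetP => u; rewrite in_G => /andP[].
Qed.

Let G_D : G \subset D.
Proof. by apply: subset_trans (@G_N x _) (@N_D x _); rewrite !inE eqxx. Qed.

Let D_XY u : u \in D -> u \notin [set x; y].
Proof. by rewrite in_D !inE; case: (u == x); case: (u == y). Qed.

Let G_adj a v : a \in [set x; y] -> v \in G -> exists2 e, inc a e & inc v e.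
Proof.
move=> ha /(subsetP (G_N ha)); rewrite in_setD => /andP[vxy].
rewrite inE; case: eqVneq => [va|_ /andP[_ /existsP[e /andP[ae ve]]]].
  by rewrite va ha in vxy.
by exists e.
Qed.

Lemma common_supportsI T T' :
  common_supports T :&: common_supports T' = common_supports (T :&: T').
Proof.
apply/setP => B; rewrite !inE /inl_set imsetI => [|? ? _ _]; last exact: inl_inj.
by rewrite subsetI; case: [exists _ in _, _]; rewrite //= ?andbF.
Qed.

Lemma powerset_common_supportsI T :
  G \subset T -> powerset (inl_set G) :&: common_supports T = common_supports G.
Proof.
move=> GT; apply/setP => B; rewrite !inE andbCA; congr andb.
by apply/andP/idP => [[]//|BG]; rewrite BG (subset_trans BG) ?inl_setS.
Qed.

Lemma support_sum_join T : G \subset T ->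
  support_sum (join_supports T) = support_sum (powerset (inl_set G)) +
    support_sum (common_supports T) - support_sum (common_supports G).
Proof. by move=> GT; rewrite support_sumU powerset_common_supportsI. Qed.

Lemma join_supports_XY T a B : T \subset D -> a \in [set x; y] ->
  B \in join_supports T -> inl a \notin B.
Proof.
move=> TD ha BT; have BD : B \subset inl_set D.
  move: BT; rewrite !inE => /orP[|/andP[_]] /subset_trans; apply; exact: inl_setS.
by apply/negP => /(subsetP BD); rewrite in_inl_set => /D_XY; rewrite ha.
Qed.

(** Common criterion for [GL], [GLx] and [GLy]: their edges have two vertices, which excludes new
    vertices, and from a vertex of [G] they lead exactly to its neighbours in [T]. *)
Lemma subgraph_supports_common (L : subgraph Gam) T : L.1 = G -> G \subset T ->
    (forall v u, v \in G -> u != v ->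
      [exists e in L.2, inc v e && inc u e] =
      [exists e, inc v e && inc u e] && (u \in T)) ->
    (forall e, e \in L.2 -> #|ends e| = 2%N) ->
  subgraph_supports L = common_supports T.
Proof.
move=> L1 GT L2 Le; apply/setP => B; apply/subgraph_supportsP/idP.
  case=> v []; rewrite L1 => vG vB hB; rewrite inE.
  have hB' w : w \in B -> (w \in star v) && (w \in inl_set T).
    have [-> _|wv wB] := eqVneq w (inl v).
      by rewrite star_refl in_inl_set (subsetP GT).
    have [e [eL ve we]] := hB w wB wv; case: w wv we {wB} => [u|[f i]] uv ue.
      rewrite in_star in_inl_set (negPf uv) -[X in X && _]/[exists e, inc v e && inc u e].
      rewrite -(L2 v u vG); last by apply: contraNneq uv => ->.
      by apply/existsP; exists e; rewrite eL ve.
    by case: (@ordinal_ends_void _ f) => //; move/eqP: ue => /= ->; exact: Le.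
  apply/andP; split; last by apply/subsetP => w /hB' /andP[].
  apply/existsP; exists v; rewrite vG inE vB.
  by apply/subsetP => w /hB' /andP[].
rewrite inE => /andP[/existsP[v /andP[vG]]]; rewrite inE => /andP[vB /subsetP Bv].
move=> /subsetP BT; exists v; split=> [||w wB wv]; rewrite ?L1 //.
have := BT w wB; case/imsetP => u uT ew; subst w.
have uv : u != v by apply: contraNneq wv => ->.
have : [exists e in L.2, inc v e && inc u e].
  by rewrite L2 // uT andbT; have := Bv _ wB; rewrite in_star (negPf wv).
by case/existsP => e /and3P[eL ve ue]; exists e.
Qed.

Let Delta_card e : e \in (Delta x y).2 -> #|ends e| = 2%N.
Proof. by rewrite inE => /andP[/eqP]. Qed.

Let Delta_inc e u : e \in (Delta x y).2 -> inc u e -> u \in D.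
Proof. by rewrite inE => /andP[_ /subsetP h] ue; apply: h; rewrite inE. Qed.

Let inc_Delta e u v :
  u != v -> u \in D -> v \in D -> inc u e -> inc v e -> e \in (Delta x y).2.
Proof.
move=> uv uD vD ue ve; rewrite in_set (ends_eq2 uv ue ve) cards2 uv /=.
by apply/subsetP => z; rewrite in_set2 => /orP[] /eqP->.
Qed.

Lemma GL_supports : subgraph_supports (GL x y) = common_supports D.
Proof.
apply: subgraph_supports_common => // [v u vG uv|e]; last first.
  by rewrite inE => /andP[/Delta_card].
apply/existsP/andP => [[e /and3P[eL ve ue]]|[/existsP[e /andP[ve ue]] uD]].
  split; first by apply/existsP; exists e; rewrite ve.
  by move: eL; rewrite inE => /andP[/Delta_inc/(_ ue)].
exists e; rewrite ve ue !andbT inE (inc_Delta uv uD (subsetP G_D _ vG) ue ve) /=.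
by apply/existsP; exists v; rewrite vG.
Qed.

Lemma GL_of_supports a b : a \in [set x; y] -> b \in [set x; y] ->
  subgraph_supports (GL_of x y a b) = common_supports (N a).
Proof.
move=> ha hb; apply: subgraph_supports_common => // [|v u vG uv|e]; last first.
- by rewrite inE => /andP[/Delta_card].
- apply/existsP/andP => [[e /and3P[eL ve ue]]|[/existsP[e /andP[ve ue]] uN]].
    split; first by apply/existsP; exists e; rewrite ve.
    move: eL; rewrite inE => /andP[eD /existsP[u' /andP[u'G]]].
    case/existsP=> v' /and4P[/setD1P[_ v'a] u'v' u'e v'e].
    (* The edge [e] has no ends besides [u'] and [v'], and both lie in [ball1 a]. *)
    have : u \in [set u'; v'] by rewrite -(ends_eq2 u'v' u'e v'e) inE.
    rewrite in_set2 => /orP[] /eqP eu; first by rewrite eu (subsetP (G_N ha)).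
    by rewrite in_setD D_XY ?(Delta_inc eD ue) // eu.
  have uD := subsetP (N_D ha) u uN.
  exists e; rewrite ve ue !andbT inE (inc_Delta uv uD (subsetP G_D _ vG) ue ve) /=.
  apply/existsP; exists v; rewrite vG; apply/existsP; exists u.
  rewrite ve ue [v == u]eq_sym uv !andbT; case/setDP: uN => ua uxy.
  by rewrite in_setD1 ua andbT; apply: contraNneq uxy => ->.
exact: G_N.
Qed.

(** * Supports of the cone over [GL] and of the stars of [x] and [y] *)

Let XY_star a : a \in [set x; y] -> XY \subset star a.
Proof.
move=> ha; have ae : inc a xy by move: ha; rewrite in_set2 => /orP[] /eqP->.
apply/subsetP => w; rewrite in_set2 in_star => w_xy; apply/orP; right.
by apply/existsP; exists xy; rewrite ae; case/orP: w_xy => /eqP->.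
Qed.

Let XY_star_G v : v \in G -> XY \subset star v.
Proof.
move=> vG; apply/subsetP => w; rewrite in_set2 => w_xy.
have [a ha ->] : exists2 a, a \in [set x; y] & w = inl a.
  by case/orP: w_xy => /eqP->; [exists x | exists y]; rewrite // !inE eqxx ?orbT.
rewrite in_star; apply/orP; right.
by have [e ae ve] := G_adj ha vG; apply/existsP; exists e; rewrite ve.
Qed.

(** The stars to which this is applied contain [x] and [y], so inclusion in them depends only on the
    rest of the support. *)
Let setD_XY_sub A (S : {set vbar Gam}) :
  XY \subset S -> (A :\: XY \subset S) = (A \subset S).
Proof.
move=> hS; apply/idP/idP => [h|]; last exact: subset_trans (subsetDl _ _).
by apply/subsetP => w wA; case: (boolP (w \in XY)) => [/(subsetP hS)//|wXY];
   apply: (subsetP h); rewrite in_setD wXY.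
Qed.

Let inl_XY u : (inl u \in XY) = (u \in [set x; y]).
Proof. by rewrite !in_set2. Qed.

Let inl_N a : a \in [set x; y] -> inl_set (N a) = inl_set D :&: star a.
Proof.
move=> ha; apply/setP => -[u|t]; last first.
  by rewrite in_setI; apply/idP/andP => [/imsetP[]|[/imsetP[]]].
rewrite in_setI !in_inl_set star_inl.
apply/idP/andP => [uN|[uD ua]]; last by rewrite in_setD D_XY.
by split; [apply: (subsetP (N_D ha)) | case/setDP: uN].
Qed.

Let coneGL_ends e u v : e \in (coneGL x y xy).2 -> u != v -> inc u e -> inc v e ->
  [|| (u \in [set x; y]) && (v \in [set x; y]),
      (u \in [set x; y]) && (v \in G),
      (v \in [set x; y]) && (u \in G) | e \in (GL x y).2].
Proof.
move=> eC uv ue ve; have eE := ends_eq2 uv ue ve.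
case/setU1P: eC => [e_xy|/setUP[->|]]; rewrite ?orbT //.
  move: eE; rewrite e_xy (ends_eq2 x_neq_y x_xy y_xy) => ->.
  by rewrite !in_set2 !eqxx ?orbT.
rewrite inE => /existsP[a /andP[ha /existsP[b /and3P[bG ae be]]]].
have ab : a != b.
  by apply: contraNneq (D_XY (subsetP G_D _ bG)) => <-.
have : a \in [set u; v] by rewrite -eE inE.
have : b \in [set u; v] by rewrite -eE inE.
move=> /set2P eb /set2P ea; case: eb ea ab ha bG => -> [] ->;
  by rewrite ?eqxx // => _ -> ->; rewrite ?orbT.
Qed.

Let coneGL_card e : e \in (coneGL x y xy).2 -> #|ends e| = 2%N.
Proof.
case/setU1P => [->|/setUP[]].
- by rewrite (ends_eq2 x_neq_y x_xy y_xy) cards2 x_neq_y.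
- by rewrite inE => /andP[/Delta_card].
rewrite inE => /existsP[a /andP[ha /existsP[b /and3P[bG ae be]]]].
have ab : a != b.
  by apply: contraNneq (D_XY (subsetP G_D _ bG)) => <-.
by rewrite (ends_eq2 ab ae be) cards2 ab.
Qed.

Let coneGL_edge e a v : a \in [set x; y] -> v \in G -> inc a e -> inc v e ->
  e \in (coneGL x y xy).2.
Proof.
move=> ha vG ae ve; apply/setU1P; right; apply/setUP; right; rewrite inE.
by apply/existsP; exists a; rewrite ha; apply/existsP; exists v; rewrite ae vG.
Qed.

(** Supports are sorted by centre: one in [G] is adjacent to [x] and [y], which are then free, while
    the star of [x] or [y] inside the cone consists of [x], [y] and [G]. *)
Lemma coneGL_supportsE A : (A \in subgraph_supports (coneGL x y xy)) =
  (A :\: XY \in common_supports D) ||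
  [exists a in [set x; y], inl a \in A] && (A :\: XY \subset inl_set G).
Proof.
apply/subgraph_supportsP/orP => [[v [vC vA hA]]|].
  (* Every edge of the cone has two vertices in [Gam], so no new vertex occurs in a support. *)
  have hu w : w \in A :\: XY -> w != inl v -> exists u e,
      [/\ w = inl u, u \notin [set x; y], u != v & inc v e && inc u e] /\
      e \in (coneGL x y xy).2.
    case/setDP => wA wXY wv; have [e [eC ve we]] := hA w wA wv.
    case: w {wA} wXY wv we => [u|[f i]] wXY wv we.
      by exists u, e; rewrite ve -inl_XY.
    by case: (@ordinal_ends_void _ f) => //; move/eqP: we => /= ->; apply: coneGL_card.
  case/setUP: vC => [vXY|vG]; [right|left].
    apply/andP; split; first by apply/existsP; exists v; rewrite vXY.
    apply/subsetP => w wA; have wv : w != inl v.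
      by apply: contraTneq wA => ->; rewrite in_setD inl_XY vXY.
    have [u [e [[-> uXY uv /andP[ve ue]] eC]]] := hu w wA wv.
    have := coneGL_ends eC uv ue ve; rewrite (negPf uXY) vXY /= in_inl_set.
    (* An edge of [GL] avoids [x] and [y], hence the centre [v]. *)
    case/orP => [//|]; rewrite inE => /andP[/Delta_inc/(_ ve)/D_XY].
    by rewrite vXY.
  have vXY := D_XY (subsetP G_D _ vG).
  have hw w : w \in A :\: XY -> (w \in star v) && (w \in inl_set D).
    have [-> _|wv wA] := eqVneq w (inl v).
      by rewrite star_refl in_inl_set (subsetP G_D).
    have [u [e [[-> uXY uv /andP[ve ue]] eC]]] := hu w wA wv.
    have := coneGL_ends eC uv ue ve; rewrite (negPf uXY) (negPf vXY) /=.
    rewrite inE => /andP[/Delta_inc/(_ ue) uD _]; rewrite in_inl_set uD andbT.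
    by rewrite in_star; apply/orP; right; apply/existsP; exists e; rewrite ve.
  rewrite inE; apply/andP; split; last by apply/subsetP => w /hw/andP[].
  apply/existsP; exists v; rewrite vG inE in_setD inl_XY vXY vA.
  by apply/subsetP => w /hw/andP[].
have XYP w : w \in XY -> exists2 a, a \in [set x; y] & w = inl a.
  by case/set2P => ->; [exists x | exists y]; rewrite // !inE eqxx ?orbT.
case=> [|/andP[/existsP[a /andP[ha aA]] /subsetP hA]].
  rewrite inE => /andP[/existsP[v /andP[vG]]].
  rewrite inE => /andP[/setDP[vA _] /subsetP Av /subsetP AD].
  exists v; split=> // [|w wA wv]; first by apply/setUP; right.
  have [/XYP[a ha ew]|wXY] := boolP (w \in XY).
    have [e ae ve] := G_adj ha vG; exists e; rewrite ew.
    by split=> //; apply: coneGL_edge ae ve.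
  have wAXY : w \in A :\: XY by rewrite in_setD wXY.
  have /imsetP[u uD ew] := AD w wAXY; have := Av w wAXY.
  rewrite in_star (negPf wv) ew => /existsP[e /andP[ve ue]]; exists e; split=> //.
  have uv : u != v by apply: contraNneq wv => <-; rewrite ew.
  apply/setU1P; right; apply/setUP; left; rewrite inE.
  rewrite (inc_Delta uv uD (subsetP G_D _ vG) ue ve) /=.
  by apply/existsP; exists v; rewrite vG.
(* Centre [a]: the edge [xy] reaches the other end, and the edges joining [a] to [G] reach the
   rest. *)
exists a; split=> // [|w wA wa]; first by apply/setUP; left.
have [/XYP[b hb ew]|wXY] := boolP (w \in XY).
  exists xy; rewrite ew; split; first exact: setU11.
    by case/set2P: ha => ->.
  by case/set2P: hb => ->.
have wAXY : w \in A :\: XY by rewrite in_setD wXY.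
have /imsetP[u uG ew] := hA w wAXY; have [e ae ue] := G_adj ha uG.
by exists e; rewrite ew; split=> //; apply: coneGL_edge ae ue.
Qed.

Let common_join T B : B \in common_supports T -> B \in join_supports T.
Proof. by move=> BT; apply/setUP; right. Qed.

Let setD_XY_id A : (forall a, a \in [set x; y] -> inl a \notin A) -> A :\: XY = A.
Proof.
move=> hA; apply/setDidPl; rewrite disjoint_sym disjoint_subset; apply/subsetP => w.
by case/set2P => ->; apply: hA; rewrite !inE eqxx ?orbT.
Qed.

Let meets_XYP A : [exists a in [set x; y], inl a \in A] = false -> A :\: XY = A.
Proof.
move/negbT/existsPn => h; apply: setD_XY_id => a ha.
by have := h a; rewrite ha.
Qed.

(** A support of the cone containing neither [x] nor [y] comes from [GL]; on the right, removing
    [join_supports D] likewise leaves only supports that meet [x] or [y]. *)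
Lemma coneGL_supports_GL : subgraph_supports (coneGL x y xy) :\: common_supports D =
  [set A : {set vbar Gam} | A :\: XY \in join_supports D] :\: join_supports D.
Proof.
apply/setP => A; rewrite in_setD coneGL_supportsE [in RHS]in_setD
  [X in _ = _ && X]in_set.
case E: [exists a in _, _]; last first.
  by rewrite (meets_XYP E) orbF !andNb.
have /existsP[a /andP[ha aA]] := E.
have AJ : A \notin join_supports D.
  by apply: contraTN aA => /(join_supports_XY (subxx _) ha).
have AC : A \notin common_supports D by apply: contra AJ => /common_join.
by rewrite AJ AC /= [in RHS]in_setU powersetE orbC.
Qed.

Lemma common_supports_coneGL :
  common_supports D \subset subgraph_supports (coneGL x y xy).
Proof.
apply/subsetP => A AD; rewrite coneGL_supportsE setD_XY_id ?AD // => a ha.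
exact: join_supports_XY (subxx _) ha (common_join AD).
Qed.

(** Inclusion in the star of [a] cuts [D] down to [N a], whereas subsets of [G] lie in that star
    already; the other end of [xy] stays free. *)
Lemma star_coneGL_supports a : a \in [set x; y] ->
  star_supports a :&: subgraph_supports (coneGL x y xy) :\: common_supports D =
  [set A : {set vbar Gam} | (inl a \in A) && (A :\: XY \in join_supports (N a))].
Proof.
move=> ha; apply/setP => A; rewrite in_setD in_setI coneGL_supportsE [RHS]in_set.
rewrite [_ \in star_supports a]inE.
have [aA|] /= := boolP (inl a \in A); last by rewrite andbF.
have AC : A \notin common_supports D.
  by apply: contraTN aA => /common_join/(join_supports_XY (subxx _) ha).
have -> : [exists b in [set x; y], inl b \in A] by apply/existsP; exists a; rewrite ha.
rewrite AC /= -(setD_XY_sub A (XY_star ha)) in_setU powersetE !inE (inl_N ha) subsetI.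
have GNa : inl_set G \subset star a.
  by apply: subset_trans (inl_setS (G_N ha)) _; rewrite inl_N // subsetIr.
case: (boolP (A :\: XY \subset inl_set G)) => [AG|_] /=.
  by rewrite (subset_trans AG GNa) orbT.
by rewrite orbF andbC andbA.
Qed.

(** A new vertex lies in at most one star, so the common part of the stars of [x] and [y] consists
    of vertices of [Gam]. *)
Let inl_G : inl_set G = (star x :&: star y) :\: XY.
Proof.
apply/setP => w; apply/idP/setDP => [wG|[/setIP[wx wy] wXY]].
  have xin : x \in [set x; y] := set21 x y; have yin : y \in [set x; y] := set22 x y.
  have /imsetP[u uG ew] := wG.
  rewrite ew inl_XY D_XY ?(subsetP G_D) //; split=> //.
  rewrite in_setI !star_inl; move: (subsetP (G_N xin) u uG) (subsetP (G_N yin) u uG).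
  by case/setDP => -> _ /setDP[-> _].
have [z ew /andP[zx zy]] := star_common x_neq_y wx wy.
rewrite ew inl_XY in wXY *; rewrite in_inl_set.
by rewrite in_G !in_setD wXY zx zy.
Qed.

Lemma stars_meet : star_supports x :&: star_supports y =
  [set A : {set vbar Gam} | [&& inl x \in A, inl y \in A &
                             A :\: XY \in powerset (inl_set G)]].
Proof.
apply/setP => A; rewrite in_setI [RHS]in_set powersetE !in_set.
case: (inl x \in A) => //=; case: (inl y \in A); rewrite ?andbF //=.
rewrite inl_G subsetD disjoints_subset subsetDr.
have hXY : XY \subset star x :&: star y.
  by rewrite subsetI !XY_star ?set21 ?set22.
by rewrite (setD_XY_sub _ hXY) subsetI andbT.
Qed.

(** A further centre [v] of a support containing [x] and [y] is a common neighbour of them; the rest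
    lies in the stars of both [v] and [a], hence in [N a]. *)
Let star_other a A : a \in [set x; y] -> inl x \in A -> inl y \in A ->
  (A \in star_supports a) && (A \in other_supports x y) =
  (A :\: XY \in common_supports (N a)).
Proof.
move=> ha xA yA; have aA : inl a \in A by case/set2P: ha => ->.
rewrite inE aA; apply/andP/idP => [[/subsetP Aa /bigcupP[v]]|].
  rewrite in_setC => vXY; rewrite inE => /andP[vA /subsetP Av].
  have vG : v \in G.
    rewrite in_G !in_setD vXY /= ![v \in _]ball1_sym -!star_inl.
    by rewrite !Av.
  rewrite inE; apply/andP; split.
    apply/existsP; exists v; rewrite vG inE in_setD inl_XY vXY vA /=.
    by apply/subsetP => w /setDP[/Av].
  apply/subsetP => w /setDP[wA wXY].
  have av : a != v by apply: contraNneq vXY => <-.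
  have [z ew /andP[za zv]] := star_common av (Aa _ wA) (Av _ wA).
  by rewrite ew in_inl_set in_setD za -inl_XY -ew wXY.
rewrite inE => /andP[/existsP[v /andP[vG]]].
rewrite inE => /andP[/setDP[vA vXY] Av]; rewrite inl_N // subsetI => /andP[_ Aa].
split; first by rewrite -(setD_XY_sub _ (XY_star ha)).
apply/bigcupP; exists v; first by rewrite in_setC -inl_XY.
by rewrite inE vA -(setD_XY_sub _ (XY_star_G vG)).
Qed.

Lemma stars_other :
  (star_supports x :|: star_supports y) :&: other_supports x y :&:
    [set A : {set vbar Gam} | (inl x \in A) && (inl y \in A)] =
  [set A : {set vbar Gam} | [&& inl x \in A, inl y \in A &
     A :\: XY \in common_supports (N x) :|: common_supports (N y)]].
Proof.
apply/setP => A; rewrite 2!in_setI [X in _ && X]in_set [RHS]in_set.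
have [xA|] /= := boolP (inl x \in A); last by rewrite andbF.
have [yA|] /= := boolP (inl y \in A); last by rewrite andbF.
by rewrite andbT !in_setU andb_orl !star_other ?set21 ?set22.
Qed.

(** * Evaluation of the support sums near [xy] *)

Let x_in : x \in [set x; y]. Proof. exact: set21. Qed.

Let y_in : y \in [set x; y]. Proof. exact: set22. Qed.

Let inl_neq : (inl x : vbar Gam) != inl y.
Proof. by apply: contraNneq x_neq_y => -[->]. Qed.

Let XY_notin T B : T \subset D -> B \in join_supports T ->
  (inl x \notin B) * (inl y \notin B).
Proof. by move=> TD BT; split; apply: join_supports_XY BT. Qed.

Let N_I : N x :&: N y = G. Proof. by rewrite /N -setDIl. Qed.

(** The free coordinates at [x] and [y] give ['X ^+ 2], and 1 is taken off for the supports meeting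
    neither. *)
Lemma support_sum_coneGL :
  support_sum (subgraph_supports (coneGL x y xy)) - support_sum (common_supports D) =
  ('X ^+ 2 - 1) * support_sum (join_supports D).
Proof.
rewrite -support_sumD_sub ?common_supports_coneGL // coneGL_supports_GL.
rewrite support_sumD_sub; last first.
  apply/subsetP => A AJ; rewrite in_set setD_XY_id // => a ha.
  exact: join_supports_XY ha AJ.
rewrite support_sum_del2 // => [|B|B]; last 2 first.
- by case/(XY_notin (subxx _)).
- by case/(XY_notin (subxx _)).
by rewrite mulrBl mul1r.
Qed.

Lemma support_sum_stars_meet : support_sum (star_supports x :&: star_supports y) =
  ('X - 1) ^+ 2 * support_sum (powerset (inl_set G)).
Proof.
have GJ B : B \in powerset (inl_set G) -> B \in join_supports D.
  by move=> BG; apply/setUP; left.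
by rewrite stars_meet support_sum_add2 // => B /GJ /(XY_notin (subxx _))[].
Qed.

(** Both coordinates are nonzero; the bracket is inclusion and exclusion with [N x :&: N y = G]. *)
Lemma support_sum_stars_other :
  support_sum ((star_supports x :|: star_supports y) :&: other_supports x y :&:
    [set A : {set vbar Gam} | (inl x \in A) && (inl y \in A)]) =
  ('X - 1) ^+ 2 * (support_sum (common_supports (N x)) +
    support_sum (common_supports (N y)) - support_sum (common_supports G)).
Proof.
rewrite stars_other -N_I -common_supportsI -support_sumU.
by rewrite support_sum_add2 // => B /setUP[] /common_join;
  case/(XY_notin (N_D _)).
Qed.

Lemma GL_of_sub a b : (GL_of x y a b).2 \subset (GL x y).2.
Proof.
apply/subsetP => e; rewrite !inE => /andP[->] /existsP[u /andP[uG]].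
case/existsP => v /and4P[_ _ ue _]; apply/existsP; exists u.
by rewrite ue andbT.
Qed.

(** The coordinate at [a] is nonzero and the one at the other end of [xy] is free. *)
Lemma class_star_coneGL a : a \in [set x; y] ->
  ('X - 1) * class (locusD (locusI (affine_at a) (subscheme (coneGL x y xy)))
                    (subscheme (GL x y))) =
  ('X - 1) * ('X * support_sum (join_supports (N a))).
Proof.
move=> ha.
transitivity (support_sum (star_supports a :&: subgraph_supports (coneGL x y xy)
                            :\: common_supports D)).
  apply: support_sum_supports => [F X|].
    rewrite in_setD in_setI -GL_supports -!subgraph_supports_nz /locusD /locusI andbC.
    by rewrite /affine_at cellE [_ \in star_supports a]inE.
  by rewrite in_setD in_setI [_ \in star_supports a]inE in_set0 /= andbF.
rewrite star_coneGL_supports //; have NaD := N_D ha.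
move: ha; rewrite in_set2 => /orP[] /eqP ea; rewrite ea in NaD *.
  by apply: support_sum_add_del => // B; apply: join_supports_XY.
(* For [a = y] the two points exchange roles. *)
rewrite /XY setUC; apply: support_sum_add_del => [|B|B]; first by rewrite eq_sym.
  exact: join_supports_XY.
exact: join_supports_XY.
Qed.

End NeighbourhoodSupports.

(* Stated over an abstract domain: rewriting under these sums unfolds polynomial
   multiplication when the ring is {poly int}. *)
Lemma resolution_identity (R : idomainType) (I : finType) (P : {set I})
    (f g h : I -> R) (z cG cR cC cL cX cY p sD sX sY sG : R) :
    z - 1 != 0 ->
    (z - 1) * cG - (z - 1) * cR =
      - ((z - 1) ^+ 2 * p) - (z - 1) ^+ 2 * (sX + sY - sG) ->
    (z - 1) * cC - sD = (z ^+ 2 - 1) * (p + sD - sG) ->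
    (z - 1) * cL = sD ->
    (z - 1) * cX = (z - 1) * (z * (p + sX - sG)) ->
    (z - 1) * cY = (z - 1) * (z * (p + sY - sG)) ->
    \sum_(i in P) (z - 1) * f i = sD ->
    \sum_(i in P) (z - 1) * g i = sX ->
    \sum_(i in P) (z - 1) * h i = sY ->
  cG - cR = (cC - cL) - cX - cY - \sum_(i in P) (z ^+ 2 - 1) * f i
    + \sum_(i in P) (z - 1) * g i + \sum_(i in P) (z - 1) * h i.
Proof.
move=> z1 hG hC hL /(mulfI z1)-> /(mulfI z1)-> hf -> ->.
have -> : \sum_(i in P) (z ^+ 2 - 1) * f i = (z + 1) * sD.
  by rewrite -hf mulr_sumr; apply: eq_bigr => i _; ring.
apply: (mulfI z1); rewrite mulrBr hG.
move/eqP: hC; rewrite subr_eq => /eqP hC.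
(* Exposes [(z - 1) * cC] and [(z - 1) * cL], the forms in which the hypotheses give these
   classes. *)
have -> (c : R) : (z - 1) * (cC - cL - z * (p + sX - sG) - z * (p + sY - sG)
    - c + sX + sY) = (z - 1) * cC - (z - 1) * cL
    + (z - 1) * (- z * (p + sX - sG) - z * (p + sY - sG) - c + sX + sY) by ring.
(* The terms in [sD] cancel, and both sides become [- (z - 1) ^+ 2 * (p + sX + sY - sG)]. *)
rewrite hC hL; ring.
Qed.

(** * The resolution formula assembled from its support sums *)

Theorem mainTheorem7 (Gam : looseGraph) (Gam_connected : connected Gam)
  (x y : vertex Gam) (xy : edge Gam)
  (x_neq_y : x != y) (x_xy : inc x xy) (y_xy : inc y xy) :
  class (@scheme Gam) - class (@scheme (resolve x y xy)) =
    (class (subscheme (coneGL x y xy)) - class (subscheme (GL x y)))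
    - class (locusD (locusI (affine_at x) (subscheme (coneGL x y xy)))
                    (subscheme (GL x y)))
    - class (locusD (locusI (affine_at y) (subscheme (coneGL x y xy)))
                    (subscheme (GL x y)))
    - \sum_(C in components (GL x y)) ('X ^+ 2 - 1) * class (subscheme C)
    + \sum_(C in components (GL x y))
        ('X - 1) * class (subscheme (subgraphI C (GLx x y)))
    + \sum_(C in components (GL x y))
        ('X - 1) * class (subscheme (subgraphI C (GLy x y))).
Proof.
have x_in : x \in [set x; y] := set21 x y.
have y_in : y \in [set x; y] := set22 x y.
have ends_neq0 e := connected_ends x e Gam_connected.
(* Old edges keep their ends and each new one has one vertex, so the resolved scheme has no
   multiplicative group either, even if the resolved graph is disconnected. *)
have ends_resolve_neq0 (e : edge (resolve x y xy)) : ends e != set0.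
  case: e => [f|b]; first exact: ends_neq0.
  by rewrite [ends _](resolve_ends_new x y xy b) -card_gt0 cards1.
pose s T := support_sum (common_supports x y T).
pose G := (Gxy x y).1; pose D := (Delta x y).1.
pose p := support_sum (powerset (inl_set G)).
pose Nx := ball1 x :\: [set x; y]; pose Ny := ball1 y :\: [set x; y].
have joinE (T : {set vertex Gam}) : G \subset T ->
    support_sum (join_supports x y T) = p + s T - s G.
  exact: support_sum_join.
have GNx : G \subset Nx by apply/subsetP => u; rewrite !inE => /and3P[-> ->].
have GNy : G \subset Ny by apply/subsetP => u; rewrite !inE => /and3P[-> _ ->].
have GD : G \subset D by apply/subsetP => u; rewrite !inE => /and3P[-> ->].
have hdiff := support_sum_resolve x_neq_y x_xy y_xy.
rewrite -!class_scheme // (support_sum_stars_meet x_neq_y x_xy y_xy) in hdiff.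
rewrite (support_sum_stars_other x_neq_y x_xy y_xy) in hdiff.
have hGL : ('X - 1) * class (subscheme (GL x y)) = s D.
  by rewrite class_subscheme GL_supports.
have hcone := support_sum_coneGL x_neq_y x_xy y_xy.
rewrite -class_subscheme joinE // in hcone.
have hcomp (L' : subgraph Gam) :
    L'.1 = (GL x y).1 -> L'.2 \subset (GL x y).2 ->
    \sum_(C in components (GL x y))
      ('X - 1) * class (subscheme (subgraphI C L')) =
    support_sum (subgraph_supports L').
  move=> h1 h2; rewrite (subgraph_supports_components h1 h2).
  by apply: eq_bigr => C _; rewrite class_subscheme.
(* The case [L' = GL], where intersecting a component with [GL] changes nothing. *)
have hC : \sum_(C in components (GL x y)) ('X - 1) * class (subscheme C) = s D.
  rewrite /s -GL_supports -(hcomp (GL x y) erefl (subxx _)).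
  by apply: eq_bigr => C hC; rewrite subgraphI_component.
have hCx : \sum_(C in components (GL x y))
    ('X - 1) * class (subscheme (subgraphI C (GLx x y))) = s Nx.
  by rewrite hcomp ?GL_of_sub // GL_of_supports.
have hCy : \sum_(C in components (GL x y))
    ('X - 1) * class (subscheme (subgraphI C (GLy x y))) = s Ny.
  by rewrite hcomp ?GL_of_sub // GL_of_supports.
have hAx := class_star_coneGL x_neq_y x_xy y_xy x_in.
have hAy := class_star_coneGL x_neq_y x_xy y_xy y_in.
rewrite joinE // in hAx; rewrite joinE // in hAy.
have t0 : ('X - 1 : {poly int}) != 0 by rewrite polyXsubC_eq0.
exact: (resolution_identity t0 hdiff hcone hGL hAx hAy hC hCx hCy).
Qed.
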